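(* Let $\Gamma=\mathrm{Cay}(\mathbb{Z}_n,S)$ be a connected $|S|$-regular graph, where $n$ and $|S|$ are even. Suppose there exist elements $x^t,x^r\in S$ such that $t$ is odd and $r$ is even. Then $\Gamma$ contains no $(0,|S|)$-regular set.
   Context: $\mathbb{Z}_n=\langle x\rangle$ denotes the cyclic group of order $n$, written multiplicatively, with identity $e$, and $S\subseteq\mathbb{Z}_n\setminus\{e\}$ is inverse-closed. The Cayley graph $\mathrm{Cay}(\mathbb{Z}_n,S)$ is the simple graph with vertex set $\mathbb{Z}_n$ in which $y$ and $z$ are adjacent if and only if $y^{-1}z\in S$. For a graph $\Gamma$ and nonnegative integers $a,b$, a nonempty proper subset $C$ of $V(\Gamma)$ is an $(a,b)$-regular set of $\Gamma$ if every vertex in $C$ has exactly $a$ neighbours in $C$ and every vertex in $V(\Gamma)\setminus C$ has exactly $b$ neighbours in $C$. *)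

(* Defs.v *)
From mathcomp Require Import all_boot all_fingroup all_solvable.

Set Implicit Arguments.
Unset Strict Implicit.
Unset Printing Implicit Defensive.

Import GroupScope.

(* A finite simple graph is a symmetric irreflexive [e : rel T] on its vertex
   type [T : finType]. *)
Section Graph.

Variables (T : finType) (e : rel T).

Definition neighbours (v : T) : {set T} := [set w | e v w].

Definition connected_graph : Prop := forall v w : T, connect e v w.

Definition regular_graph (k : nat) : Prop := forall v : T, #|neighbours v| = k.

Definition regular_set (a b : nat) (C : {set T}) : Prop :=
  [/\ C != set0,
      C \proper [set: T],
      forall v : T, v \in C -> #|neighbours v :&: C| = a
    & forall v : T, v \notin C -> #|neighbours v :&: C| = b].

End Graph.

Definition inverse_closed (gT : finGroupType) (S : {set gT}) : Prop :=
  forall s : gT, s \in S -> s^-1 \in S.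

Definition Cay (gT : finGroupType) (S : {set gT}) : rel gT :=
  fun y z => y^-1 * z \in S.

Lemma Cay_sym (gT : finGroupType) (S : {set gT}) :
  inverse_closed S -> symmetric (Cay S).
Proof.
move=> SV y z; rewrite /Cay; apply/idP/idP => /SV; by rewrite invMg invgK.
Qed.

Lemma Cay_irr (gT : finGroupType) (S : {set gT}) :
  1 \notin S -> irreflexive (Cay S).
Proof. by move=> S1 y; rewrite /Cay mulVg; apply: negbTE. Qed.

Lemma Cay_regular (gT : finGroupType) (S : {set gT}) :
  regular_graph (Cay S) #|S|.
Proof.
move=> y; rewrite -(card_lcoset S y); apply: eq_card => z.
by rewrite inE mem_lcoset.
Qed.

(* Main.v *)
Require Import Defs.
From mathcomp Require Import all_boot all_fingroup all_solvable.

Set Implicit Arguments.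
Unset Strict Implicit.
Unset Printing Implicit Defensive.

Import GroupScope.

(** A (0, k)-regular set of a k-regular graph is one side of a bipartition:
    every edge joins it to its complement ([regular_set0_flip]).  In a Cayley
    graph this means that right multiplication by any element of S exchanges
    the set and its complement, so multiplying m times by the same element of
    S changes sides exactly when m is odd ([regular_set0_mulX]).  Now reach
    x ^+ (t * r) from the identity in two ways: by r steps x ^+ t, an even
    number, and by t steps x ^+ r, an odd number.  The first walk says that
    x ^+ (t * r) is on the side of the identity, the second that it is not. *)

(** Inside C there are no edges because a = 0; outside C there are none because
    the k neighbours of a vertex outside C already all lie in C. *)
Lemma regular_set0_flip (T : finType) (e : rel T) (k : nat) (C : {set T}) :
    regular_graph e k -> regular_set e 0 k C ->
  forall v w : T, e v w -> (w \in C) = (v \notin C).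
Proof.
move=> reg_e [_ _ inC outC] v w evw.
have Nw : w \in neighbours e v by rewrite inE.
have [vC | vC] := boolP (v \in C).
  apply/negP => wC; move/eqP: (inC v vC); rewrite cards_eq0 => /eqP N0.
  by have := in_set0 w; rewrite -N0 inE Nw wC.
have NC : neighbours e v :&: C == neighbours e v.
  by rewrite eqEcard subsetIl reg_e (outC _ vC) leqnn.
by move: Nw; rewrite -(eqP NC) inE => /andP[].
Qed.

Lemma regular_set0_mulX (gT : finGroupType) (S C : {set gT}) (s : gT) :
    regular_set (Cay S) 0 #|S| C -> s \in S ->
  forall (m : nat) (y : gT), (y * s ^+ m \in C) = odd m (+) (y \in C).
Proof.
move=> regC sS; elim=> [|m IHm] y; first by rewrite expg0 mulg1.
have adj : Cay S (y * s ^+ m) (y * s ^+ m.+1).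
  by rewrite /Cay expgSr (mulgA y) mulKg.
by rewrite (regular_set0_flip (@Cay_regular _ S) regC adj) IHm /= addNb.
Qed.

Theorem theorem4p5 (n : nat) (gT : finGroupType) (x : gT) (S : {set gT})
    (x_gen : [set: gT] = <[x]>) (card_gT : #|[set: gT]| = n)
    (S_no1 : 1 \notin S) (S_inv : inverse_closed S)
    (Gamma_conn : connected_graph (Cay S))
    (Gamma_reg : regular_graph (Cay S) #|S|)
    (n_even : ~~ odd n) (S_even : ~~ odd #|S|)
    (S_parities : exists t r : nat,
       [/\ x ^+ t \in S, x ^+ r \in S, odd t & ~~ odd r]) :
  ~ exists C : {set gT}, regular_set (Cay S) 0 #|S| C.
Proof.
case: S_parities => t [r [xtS xrS t_odd r_even]] [C regC].
have := regular_set0_mulX regC xtS r 1.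
rewrite -expgM mulnC expgM (regular_set0_mulX regC xrS).
by rewrite t_odd (negbTE r_even); case: (1 \in C).
Qed.
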